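(* Let $G$ be a graph of order $n\geq 3$. If $d_{sp}(G)=2$, then $C_s(G)\geq 4$.
   Context: All graphs are finite, simple and undirected. The order of $G$ is $|V(G)|$. $N(v)$ denotes the open neighborhood of a vertex $v$, and for $S\subseteq V(G)$ we write $\overline{S}=V(G)\setminus S$. A set $S\subseteq V(G)$ is a dominating set if every vertex of $\overline{S}$ is adjacent to a vertex of $S$. A dominating set $S$ is a super dominating set if for every $u\in\overline{S}$ there exists $v\in S$ with $N(v)\cap\overline{S}=\{u\}$. A super domatic partition of $G$ is a partition of $V(G)$ in which every class is a super dominating set of $G$; the super domatic number $d_{sp}(G)$ is the maximum number of classes in such a partition. A super coalition partition of $G$ is a partition $\{A_1,\dots,A_k\}$ of $V(G)$ (into nonempty parts) such that (i) no part $A_i$ is a super dominating set of $G$, and (ii) for every part $A_i$ there is at least one distinct part $A_j$ ($j\neq i$) such that $A_i\cup A_j$ is a super dominating set of $G$. The super coalition number $C_s(G)$ is the maximum cardinality of a super coalition partition of $G$, with $C_s(G)=0$ if $G$ admits no super coalition partition. *)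

(* Defs.v *)
From mathcomp Require Import all_boot.

Set Implicit Arguments.
Unset Strict Implicit.
Unset Printing Implicit Defensive.

(* A finite simple graph is a symmetric irreflexive relation e on a finType T;
   symmetry and irreflexivity are hypotheses of the theorem, not used below.  *)

Definition open_nbh (T : finType) (e : rel T) (v : T) : {set T} :=
  [set u | e v u].

Definition dominating (T : finType) (e : rel T) (S : {set T}) : bool :=
  [forall u in ~: S, exists v in S, e u v].

Definition super_dominating (T : finType) (e : rel T) (S : {set T}) : bool :=
  dominating e S &&
  [forall u in ~: S, exists v in S, open_nbh e v :&: ~: S == [set u]].

(* [partition P D] requires the blocks of P to be nonempty. *)
Definition super_domatic_partition (T : finType) (e : rel T)
    (P : {set {set T}}) : bool :=
  partition P [set: T] && [forall S in P, super_dominating e S].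

Definition super_domatic_number (T : finType) (e : rel T) : nat :=
  \max_(P : {set {set T}} | super_domatic_partition e P) #|P|.

Definition super_coalition_partition (T : finType) (e : rel T)
    (P : {set {set T}}) : bool :=
  [&& partition P [set: T],
      [forall A in P, ~~ super_dominating e A]
    & [forall A in P, exists B in P,
         (B != A) && super_dominating e (A :|: B)]].

(* The maximum over an empty range is 0, as wanted when e has no super
   coalition partition. *)
Definition super_coalition_number (T : finType) (e : rel T) : nat :=
  \max_(P : {set {set T}} | super_coalition_partition e P) #|P|.

(* Main.v *)
(** A super dominating set [S] has at least half of the vertices, since each
    vertex outside [S] has a private neighbour in [S].  The two classes of a
    super domatic partition therefore have exactly half of the vertices, at
    least two each.  Split each class into two nonempty parts: every part is too
    small to be super dominating, and it forms a coalition with the other half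
    of its class. *)
Require Import Defs.
From mathcomp Require Import all_boot.

Lemma super_dominating_card {T : finType} {e : rel T} {S : {set T}} :
  super_dominating e S -> #|~: S| <= #|S|.
Proof.
case/andP=> _ /forall_inP privS.
(* [f] chooses a private neighbour; the default [u] is never reached for [u] outside [S]. *)
pose f u := odflt u [pick v in S | open_nbh e v :&: ~: S == [set u]].
have fP u : u \in ~: S -> f u \in S /\ open_nbh e (f u) :&: ~: S = [set u].
  move/privS/exists_inP=> [v vS vu]; rewrite /f.
  case: pickP => [w /andP[wS /eqP wu] //|/(_ v)].
  by rewrite vS vu.
(* The only neighbour of [f u] outside [S] is [u], so [f u] determines [u]. *)
have f_inj : {in ~: S &, injective f}.
  move=> u v /fP[_ fu] /fP[_ fv] fuv; apply: set1_inj.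
  by rewrite -fu -fv fuv.
rewrite -(card_in_imset f_inj); apply: subset_leq_card.
by apply/subsetP=> _ /imsetP[u /fP[fuS _] ->].
Qed.

Lemma partition_set1D1 {T : finType} {A : {set T}} {x : T} :
  x \in A -> 1 < #|A| -> partition [set [set x]; A :\ x] A.
Proof.
move=> xA A_gt1; rewrite -{2}(setD1K xA); apply: partitionU1.
- rewrite /partition /cover big_set1 eqxx trivIset1 inE eq_sym -card_gt0 /=.
  by move: A_gt1; rewrite (cardsD1 x) xA.
- by apply/set0Pn; exists x; rewrite inE.
- by rewrite disjoints1 !inE eqxx.
Qed.

Lemma card_set1D1 {T : finType} {A : {set T}} {x : T} :
  #|[set [set x]; A :\ x]| = 2.
Proof.
by rewrite cards2; case: eqP => // /setP/(_ x); rewrite !inE eqxx.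
Qed.

(** Blocks from different sides lie in disjoint sets. A common block would be disjoint from itself,
    hence empty; this is why the numbers of blocks add up. *)
Lemma partitionU {T : finType} {P Q : {set {set T}}} {D E : {set T}} :
  partition P D -> partition Q E -> [disjoint D & E] ->
  partition (P :|: Q) (D :|: E) /\ [disjoint P & Q].
Proof.
move=> partP partQ disjDE.
have disjPQ B C : B \in P -> C \in Q -> [disjoint B & C].
  move=> BP CQ; apply: disjointWl (disjointWr _ disjDE).
    by rewrite -(cover_partition partP) (bigcup_sup B).
  by rewrite -(cover_partition partQ) (bigcup_sup C).
split; last first.
  apply/pred0P=> B /=; apply/negP=> /andP[BP BQ].
  have := disjPQ B B BP BQ; rewrite -setI_eq0 setIid.
  exact/negP/(partition_neq0 partP).
case/and3P: partP => /eqP covP /trivIsetP tiP P0.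
case/and3P: partQ => /eqP covQ /trivIsetP tiQ Q0.
rewrite /partition /cover bigcup_setU -!/(cover _) covP covQ eqxx inE negb_or P0 Q0.
rewrite /= andbT; apply/trivIsetP=> B C; rewrite !inE.
case/orP=> B_in /orP[] C_in neqBC; first exact: tiP.
- exact: disjPQ.
- by rewrite disjoint_sym disjPQ.
- exact: tiQ.
Qed.

(** A maximum over an empty range is 0, so a positive value is attained. *)
Lemma super_domatic_number_witness {T : finType} {e : rel T} {k : nat} :
  super_domatic_number e = k.+1 ->
  exists2 P, super_domatic_partition e P & #|P| = k.+1.
Proof.
rewrite /super_domatic_number => dspE.
have [none|] := posnP #|[pred P | super_domatic_partition e P]|.
  by move: dspE; rewrite big_pred0 // => P; apply: (card0_eq none P).
by case/(eq_bigmax_cond (fun P : {set {set T}} => #|P|)) => P sdP maxP;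
  exists P; rewrite // -maxP.
Qed.

Theorem theorem3p5 (T : finType) (e : rel T)
    (e_sym : symmetric e) (e_irr : irreflexive e)
    (order_ge3 : 3 <= #|T|) (dsp2 : super_domatic_number e = 2) :
  4 <= super_coalition_number e.
Proof.
have [P /andP[partP /forall_inP sdP] /eqP/cards2P[A [B [neqAB PE]]]] :=
  super_domatic_number_witness dsp2.
rewrite {}PE in partP sdP.
have sdA : super_dominating e A by apply: sdP; rewrite set21.
have sdB : super_dominating e B by apply: sdP; rewrite set22.
have cardAB : #|A| + #|B| = #|T|.
  by rewrite -cardsT (card_partition partP) big_setU1 ?inE //= big_set1.
have leA := super_dominating_card sdA; have leB := super_dominating_card sdB.
have CA : #|~: A| = #|B| by rewrite cardsCs setCK -cardAB addKn.
have CB : #|~: B| = #|A| by rewrite cardsCs setCK -cardAB addnK.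
(* [A] and [B] are complementary, so the cardinality bound applies in both directions. *)
have cardE : #|A| = #|B| by apply/anti_leq; rewrite -{1}CB leB -{1}CA leA.
(* The order is twice [#|B|], so [#|B| <= 1] would give order at most 2. *)
have B_gt1 : 1 < #|B|.
  by move: order_ge3; rewrite -cardAB cardE; case: #|B| => [|[]].
have A_gt1 : 1 < #|A| by rewrite cardE.
(* With fewer than half of the vertices, [S] is smaller than its complement. *)
have small (S : {set T}) : #|S| < #|A| -> ~~ super_dominating e S.
  move=> ltSA; apply/negP=> /super_dominating_card; apply/negP; rewrite -ltnNge.
  apply: (leq_trans ltSA); rewrite -(leq_add2l #|S|) cardsC -cardAB -cardE.
  by rewrite leq_add2r ltnW.
have [x xA] : exists x, x \in A by apply/card_gt0P; apply: ltnW.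
have [y yB] : exists y, y \in B by apply/card_gt0P; apply: ltnW.
have disjAB : [disjoint A & B].
  by case/and3P: partP => _ /trivIsetP-> //; rewrite ?set21 ?set22.
have partA := partition_set1D1 xA A_gt1.
have partB := partition_set1D1 yB B_gt1.
have [partQ disjQ] := partitionU partA partB disjAB.
have AUB : A :|: B = [set: T].
  by rewrite -(cover_partition partP) /cover big_setU1 ?inE //= big_set1.
set Q := _ :|: _ in partQ.
have cardQ : #|Q| = 4.
  by rewrite cardsU disjoint_setI0 // cards0 !card_set1D1.
rewrite -cardQ; apply: leq_bigmax_cond; apply/and3P; split.
- by rewrite -AUB.
- apply/forall_inP=> C; rewrite !inE -!orbA => C_in; apply: small.
  case/or4P: C_in => /eqP->; rewrite ?cards1 //.
    by rewrite [leqRHS](cardsD1 x) xA.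
  by rewrite cardE [leqRHS](cardsD1 y) yB.
(* Coalition partners must be distinct parts; [z] lies in only one of these two. *)
have neqD1 (S : {set T}) z : S :\ z != [set z].
  by apply/eqP=> /setP/(_ z); rewrite !inE eqxx.
apply/forall_inP=> C; rewrite !inE -!orbA => C_in; apply/exists_inP.
case/or4P: C_in => /eqP->.
- by exists (A :\ x); rewrite ?neqD1 ?setD1K // !inE eqxx ?orbT.
- by exists [set x]; rewrite ?[_ == _ :\ _]eq_sym ?neqD1 1?setUC ?setD1K // !inE eqxx.
- by exists (B :\ y); rewrite ?neqD1 ?setD1K // !inE eqxx ?orbT.
- by exists [set y]; rewrite ?[_ == _ :\ _]eq_sym ?neqD1 1?setUC ?setD1K // !inE eqxx ?orbT.
Qed.
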